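(* The Poisson distribution family has the hierarchical low-rank property. That is, for every $\epsilon>0$ there exists a positive integer $T_\epsilon$, with $T_\epsilon=O(\mathrm{polylog}(1/\epsilon))$, such that for every integer $\ell$ and every integer $j\ge 0$, there exist real-valued functions $\alpha_i(k)$ and $\beta_i(\lambda)$, $1\le i\le T_\epsilon$ (which may depend on $\epsilon,\ell,j$), such that for all $(k,\lambda)\in B_{\ell,j}$ with $k\in\{0,1,2,\ldots\}$ and $\lambda>0$ $$e^{-\lambda}\frac{\lambda^k}{k!}=\sum_{i=1}^{T_\epsilon}\alpha_i(k)\beta_i(\lambda)+O(\epsilon).$$
   Context: For each integer $\ell$ and each integer $j\ge 0$, the block $B_{\ell,j}\subset[0,\infty)^2$ (first coordinate $k$, second coordinate $\lambda$) is $$B_{\ell,j}=\begin{cases}[j/2^\ell,(j+1)/2^\ell]\times[(j+1)/2^\ell,(j+2)/2^\ell], & j\text{ even},\\ [j/2^\ell,(j+1)/2^\ell]\times[(j-1)/2^\ell,j/2^\ell], & j\text{ odd}.\end{cases}$$ Asymptotic notation: $T_\epsilon=O(\mathrm{polylog}(1/\epsilon))$ means that there are absolute constants $A,m>0$ with $T_\epsilon\le A(\ln(1/\epsilon))^m$ for all $0<\epsilon\le 1/2$. The error term $O(\epsilon)$ denotes a quantity of absolute value at most $C\epsilon$, with $C$ an absolute constant independent of $\epsilon,\ell,j,k,\lambda$. *)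

(* Defs.v *)
From HB Require Import structures.
From mathcomp Require Import all_boot all_order all_algebra.
From mathcomp Require Import all_classical all_reals all_analysis.

Set Implicit Arguments.
Unset Strict Implicit.
Unset Printing Implicit Defensive.

Import Order.TTheory GRing.Theory Num.Theory.

Local Open Scope classical_set_scope.
Local Open Scope ring_scope.

(* [l] ranges over all integers, so [2 ^ l] is an integer power in the field
   [R].  All endpoints are computed in [R]: [j%:R - 1] is not truncated. *)
Definition block (R : realType) (l : int) (j : nat) : set (R * R) :=
  let s : R := 2 ^ l in
  `[j%:R / s, (j%:R + 1) / s]%classic `*`
  (if odd j then `[(j%:R - 1) / s, j%:R / s]%classic
   else `[(j%:R + 1) / s, (j%:R + 2) / s]%classic).

(* [T eps = O(polylog(1/eps))], as [eps] tends to 0; [`^] is the real power. *)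
Definition polylog_bounded (R : realType) (T : R -> nat) : Prop :=
  exists A m : R, [/\ 0 < A, 0 < m &
    forall eps : R, 0 < eps -> eps <= 1 / 2 ->
      (T eps)%:R <= A * ln (1 / eps) `^ m].

(* [C] is the constant of the [O(eps)] error term: it is chosen before [eps],
   [l], [j], [k] and [lam], whereas [alpha] and [beta] depend on [eps], [l]
   and [j]. *)
Definition hierarchical_low_rank (R : realType) (p : nat -> R -> R) : Prop :=
  exists T : R -> nat,
    [/\ forall eps : R, 0 < eps -> (0 < T eps)%N,
        polylog_bounded T &
        exists2 C : R, 0 < C &
          forall eps : R, 0 < eps ->
          forall (l : int) (j : nat),
          exists (alpha : 'I_(T eps) -> nat -> R)
                 (beta : 'I_(T eps) -> R -> R),
          forall (k : nat) (lam : R), 0 < lam ->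
            block l j (k%:R, lam) ->
            `|p k lam - \sum_(i < T eps) alpha i k * beta i lam| <= C * eps].

(* Main.v *)
(* Every block touches the diagonal at one corner (c, c), with k <= 2c, and k
   and lam lie on opposite sides of c. Writing lam = c e^t,
     p(k, lam) = p(k, c) q(t) e^{(k - c) t},  q(t) = exp(- c (e^t - 1 - t)),
   where all three factors are at most 1 because (k - c) t <= 0. Rows with
   p(k, c) <= eps and columns with q(t) <= eps may be replaced by 0; on the
   remaining ones |(k - c) t| = O(ln (1/eps)), by Poisson concentration and a
   Fenchel-Young inequality, so O(ln (1/eps)) terms of the Taylor series of the
   last factor, each of rank one in (k, lam), suffice. *)
Require Import Defs.
From HB Require Import structures.
From mathcomp Require Import all_boot all_order all_algebra.
From mathcomp Require Import all_classical all_reals all_analysis.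
From mathcomp Require Import ring lra.

Set Implicit Arguments.
Unset Strict Implicit.
Unset Printing Implicit Defensive.

Import Order.TTheory GRing.Theory Num.Theory.

Local Open Scope ring_scope.

Lemma exprn_fact_le_expR (R : realType) (x : R) n :
  0 <= x -> x ^+ n / n`!%:R <= expR x.
Proof.
move=> x0; case: n => [|n]; first by rewrite expr0 fact0 divr1 -expR0 ler_expR.
by apply: le_trans (expR_ge1Dxn n x0); rewrite lerDr.
Qed.

(* Each term is at most [expR (2 |x|) / 2 ^ n], being [2 ^- n] times a term of
   the exponential series of [2 |x|]. *)
Lemma expR_taylor_le (R : realType) (x : R) N :
  `|expR x - \sum_(i < N) x ^+ i / i`!%:R| <= 2 * expR (2 * `|x|) / 2 ^+ N.
Proof.
set B := (X in _ <= X); set E := expR (2 * `|x|).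
have term n : `|x ^+ n / n`!%:R| <= E * 2^-1 ^+ n.
  rewrite normrM normrX normfV [ `|n`!%:R|]ger0_norm// exprVn ler_pdivlMr ?exprn_gt0//.
  rewrite (_ : _ * _ = (2 * `|x|) ^+ n / n`!%:R); last by rewrite exprMn; ring.
  by apply: exprn_fact_le_expR; rewrite mulr_ge0.
have part d : `|\sum_(N <= i < N + d) x ^+ i / i`!%:R| <= B - 2 * E * 2^-1 ^+ (N + d).
  elim: d => [|d IH].
    by rewrite addn0 big_geq// normr0 /B exprVn subrr.
  rewrite addnS big_nat_recr ?leq_addr//= (le_trans (ler_normD _ _))//.
  have := term (N + d)%N; rewrite exprS; lra.
have near_le M : (N <= M)%N ->
    `|series (exp_coeff x) M - \sum_(i < N) x ^+ i / i`!%:R| <= B.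
  move=> NM; rewrite /series /exp_coeff /= (big_cat_nat (leq0n N) NM)//= big_mkord addrAC subrr add0r.
  rewrite -(subnKC NM) (le_trans (part _))// gerBl.
  by rewrite mulr_ge0 ?exprn_ge0 ?mulr_ge0 ?expR_ge0.
have cvx := is_cvg_series_exp_coeff x.
rewrite ler_distl; apply/andP; split.
  apply: limr_ge => //; exists N => //= M /= NM.
  by have := near_le _ NM; rewrite ler_distl => /andP[].
apply: limr_le => //; exists N => //= M /= NM.
by have := near_le _ NM; rewrite ler_distl => /andP[].
Qed.

Lemma expR_le_quadratic (R : realType) (t : R) :
  `|t| <= 1 / 2 -> expR t <= 1 + t + 2 * t ^+ 2.
Proof.
rewrite ler_norml => /andP[t1 t2].
have h : 1 - t <= expR (- t) by rewrite expR_ge1Dx.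
have q0 : 0 <= 1 + t + 2 * t ^+ 2 by nra.
(* Multiplying by [1 - t] instead gives 1 + t^2 (1 - 2 t). *)
have q1 : 1 <= (1 + t + 2 * t ^+ 2) * expR (- t).
  by apply: le_trans (ler_wpM2l q0 h); nra.
by rewrite expRN ler_pdivlMr ?expR_gt0// mul1r in q1.
Qed.

Lemma expR_half_le2 (R : realType) : expR (2^-1) <= 2 :> R.
Proof.
have := expR_ge1Dx (- 2^-1 : R); have := expRxMexpNx_1 (2^-1 : R).
have := expR_gt0 (2^-1 : R); nra.
Qed.

(* Fenchel-Young for [expR t - 1 - t], whose conjugate
   [(1 + u) ln (1 + u) - u] is at most [u ^ 2]. *)
Lemma fenchel_young_expR (R : realType) (u t : R) :
  -1 <= u -> u * t <= expR t - 1 - t + u ^+ 2.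
Proof.
rewrite le_eqVlt => /predU1P[<-|u1]; first by have := expR_ge0 t; lra.
have y0 : 0 < 1 + u by lra.
have := le_ln1Dx u1.
have := expR_ge1Dx (t - ln (1 + u)).
rewrite expRB lnK ?posrE// ler_pdivlMr//.
nra.
Qed.

(** One term of the exponential series of [c * expR t] is at most its sum. The sign of [t] is free,
    so both tails are covered. *)
Lemma poisson_chernoff (R : realType) (c t : R) k : 0 <= c ->
  expR (- c) * (c ^+ k / k`!%:R) <= expR (c * (expR t - 1) - t * k%:R).
Proof.
move=> c0.
have := exprn_fact_le_expR k (mulr_ge0 c0 (expR_ge0 t)).
rewrite exprMn -expRM_natr => H.
rewrite (_ : c * _ - _ = - c + (c * expR t - t * k%:R)); last by ring.
rewrite expRD ler_wpM2l ?expR_ge0// expRB ler_pdivlMr ?expR_gt0//.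
by apply: le_trans H; rewrite mulrAC.
Qed.

Lemma poisson_concentration (R : realType) (c : R) k : 0 < c -> k%:R <= 2 * c ->
  expR (- c) * (c ^+ k / k`!%:R) <= expR (- ((k%:R - c) ^+ 2 / (8 * c))).
Proof.
(* This [t] minimizes c (t + 2 t^2) - t k, the quadratic majorant of the Chernoff exponent;
   [k%:R <= 2 * c] keeps |t| at most 1/4. *)
move=> c0 kc; set t := (k%:R - c) / (4 * c).
have ct : k%:R = c + 4 * c * t by rewrite /t; field; lra.
have t4 : `|t| <= 1 / 2.
  have := ler0n R k; rewrite ct in kc *; rewrite ler_norml => k0.
  apply/andP; split; nra.
apply: le_trans (poisson_chernoff t k (ltW c0)) _.
rewrite ler_expR (_ : (k%:R - c) ^+ 2 / _ = 2 * c * t ^+ 2); last first.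
  by rewrite ct; field; lra.
rewrite ct; have := expR_le_quadratic t4; nra.
Qed.

(* Exponential tilting of the Poisson law of mean [c] to mean [c * expR t]. *)
Lemma poisson_tilt (R : realType) (c t : R) k :
  expR (- (c * expR t)) * ((c * expR t) ^+ k / k`!%:R) =
  expR (- c) * (c ^+ k / k`!%:R) * expR (- (c * (expR t - 1 - t)))
    * expR ((k%:R - c) * t).
Proof.
rewrite exprMn -expRM_natr.
rewrite (_ : - (c * expR t) =
  - c + - (c * (expR t - 1 - t)) + (k%:R - c) * t - t * k%:R); last by ring.
rewrite !expRD (expRN (t * _)); field.
by rewrite pnatr_eq0 -lt0n fact_gt0 expR_eq0.
Qed.

(** Put L = ln (1 / eps) and s = (k - c) / c. The two cutoffs give c s^2 < 8 L and c (e^t - 1 - t) <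
    L; Fenchel-Young at u = s and u = -s, scaled by c, bounds |c s t| by their sum. *)
Lemma tilt_exponent_le (R : realType) (c t eps : R) k :
  0 < eps -> 0 < c -> k%:R <= 2 * c ->
  eps < expR (- c) * (c ^+ k / k`!%:R) ->
  eps < expR (- (c * (expR t - 1 - t))) ->
  `|(k%:R - c) * t| <= 9 * ln (1 / eps).
Proof.
move=> e0 c0 kc; set L := ln (1 / eps).
have epsE : eps = expR (- L).
  by rewrite /L div1r lnV ?posrE// opprK lnK.
move=> /lt_le_trans/(_ (poisson_concentration c0 kc)).
rewrite epsE !ltr_expR !ltrN2 => kL tL.
set s := (k%:R - c) / c.
have kE : k%:R - c = c * s by rewrite /s; field; lra.
rewrite kE (_ : (c * s) ^+ 2 / _ = c * s ^+ 2 / 8) in kL; last by field; lra.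
have k0 := ler0n R k.
have s1 : -1 <= s by nra.
have s2 : -1 <= - s by nra.
have := fenchel_young_expR t s1; have := fenchel_young_expR t s2.
rewrite kE sqrrN ler_norml => h1 h2.
apply/andP; split; nra.
Qed.

(* With [L = ln (1 / eps)] and [|x| <= 9 L], the Taylor error of [expR x] is at
   most [2 expR (18 L) / 2 ^ N], and [2 ^ N >= expR (N / 2)]: [N >= 38 L] makes
   it at most [2 eps].  ([Num.truncn] of a negative number is 0.) *)
Definition poisson_rank (R : realType) (eps : R) : nat :=
  (Num.truncn (38 * ln (1 / eps))).+1.

Lemma poisson_low_rank_corner (R : realType) (eps c : R) : 0 < eps -> 0 < c ->
  exists (alpha : 'I_(poisson_rank eps) -> nat -> R)
         (beta : 'I_(poisson_rank eps) -> R -> R),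
  forall (k : nat) (lam : R), 0 < lam -> k%:R <= 2 * c ->
    (k%:R - c) * (lam - c) <= 0 ->
    `|expR (- lam) * (lam ^+ k / k`!%:R)
      - \sum_(i < poisson_rank eps) alpha i k * beta i lam| <= 2 * eps.
Proof.
move=> e0 c0; set N := poisson_rank eps.
pose a (k : nat) : R := expR (- c) * (c ^+ k / k`!%:R).
pose b (t : R) := expR (- (c * (expR t - 1 - t))).
pose th (lam : R) := ln (lam / c).
exists (fun i k => if a k <= eps then 0 else a k * (k%:R - c) ^+ i / i`!%:R).
exists (fun i lam => if b (th lam) <= eps then 0 else b (th lam) * th lam ^+ i).
move=> k lam lam0 kc klam.
have lamE : lam = c * expR (th lam).
  by rewrite lnK ?posrE ?divr_gt0//; field; lra.
set t := th lam in lamE *.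
(* [t] has the sign of [lam - c]. *)
have x0 : (k%:R - c) * t <= 0.
  have [kc'|kc'|->] := ltgtP (k%:R) c; last by rewrite subrr mul0r.
    rewrite mulr_le0_ge0 ?subr_le0 ?(ltW kc')// ln_ge0// ler_pdivlMr// mul1r.
    by rewrite -subr_ge0 -(nmulr_rle0 _ (_ : k%:R - c < 0)) ?subr_lt0.
  rewrite mulr_ge0_le0 ?subr_ge0 ?(ltW kc')// ln_le0// ler_pdivrMr// mul1r.
  by rewrite -subr_le0 -(pmulr_rle0 _ (_ : 0 < k%:R - c)) ?subr_gt0.
rewrite {1 2}lamE poisson_tilt -/(a k) -/(b t).
have a0 : 0 <= a k by rewrite !mulr_ge0 ?expR_ge0 ?invr_ge0 ?exprn_ge0 ?ltW.
have a1 : a k <= 1.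
  by have := poisson_chernoff 0 k (ltW c0); rewrite expR0 subrr mulr0 mul0r subrr expR0.
have b0 : 0 <= b t by exact: expR_ge0.
have b1 : b t <= 1.
  by rewrite expR_le1 oppr_le0 mulr_ge0 ?(ltW c0)//; have := expR_ge1Dx t; lra.
have f0 := expR_ge0 ((k%:R - c) * t).
have f1 : expR ((k%:R - c) * t) <= 1 by rewrite expR_le1.
have pab : a k * b t * expR ((k%:R - c) * t) <= a k * b t.
  exact: ler_piMr (mulr_ge0 a0 b0) f1.
have [ae|ae] := leP (a k) eps.
  rewrite big1 => [|i _]; last by rewrite mul0r.
  rewrite subr0 (ger0_norm (mulr_ge0 (mulr_ge0 a0 b0) f0)).
  have : a k * b t <= a k by exact: ler_piMr.
  lra.
have [be|be] := leP (b t) eps.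
  rewrite big1 => [|i _]; last by rewrite mulr0.
  rewrite subr0 (ger0_norm (mulr_ge0 (mulr_ge0 a0 b0) f0)).
  have : a k * b t <= b t by exact: ler_piMl.
  lra.
have xL := tilt_exponent_le e0 c0 kc ae be.
set x := (k%:R - c) * t in f0 f1 x0 xL *.
rewrite (eq_bigr (fun i : 'I_N => a k * b t * (x ^+ i / i`!%:R))); last first.
  by move=> i _; rewrite exprMn; ring.
rewrite -mulr_sumr -mulrBr normrM (ger0_norm (mulr_ge0 a0 b0)).
apply: (@le_trans _ _ `|expR x - \sum_(i < N) x ^+ i / i`!%:R|).
  by rewrite ler_piMl// mulr_ile1.
apply: le_trans (expR_taylor_le _ _) _.
rewrite -mulrA ler_pM2l// ler_pdivrMr ?exprn_gt0//.
set L := ln (1 / eps) in xL.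
have epsE : eps = expR (- L).
  by rewrite /L div1r lnV ?posrE// opprK lnK.
have N38 : 38 * L <= N%:R by rewrite ltW// truncnS_gt.
apply: (@le_trans _ _ (eps * expR (2^-1) ^+ N)); last first.
  by rewrite ler_pM2l// lerXn2r ?nnegrE ?expR_ge0 ?expR_half_le2.
rewrite -expRM_natr epsE -expRD ler_expR; lra.
Qed.

Lemma block_corner (R : realType) (l : int) (j : nat) :
  exists2 c : R, 0 < c & forall x y : R, block l j (x, y) ->
    x <= 2 * c /\ (x - c) * (y - c) <= 0.
Proof.
rewrite /block; set s : R := 2 ^ l.
have s0 : 0 < s^-1 by rewrite invr_gt0 exprz_gt0.
case: (boolP (odd j)) => oj.
  (* An odd [j] is at least 1, so the corner j / s is positive and (j + 1) / s is at most twice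
     it. *)
  have j1 : 1 <= j%:R :> R by rewrite ler1n; case: j oj.
  exists (j%:R / s); first by rewrite mulr_gt0//; lra.
  move=> x y [] /=; rewrite !in_itv /= => /andP[x1 x2] /andP[y1 y2].
  split; nra.
have j0 := ler0n R j.
exists ((j%:R + 1) / s); first by rewrite mulr_gt0//; lra.
move=> x y [] /=; rewrite !in_itv /= => /andP[x1 x2] /andP[y1 y2].
split; nra.
Qed.

Theorem mainTheorem6 (R : realType) :
  hierarchical_low_rank
    (fun (k : nat) (lam : R) => expR (- lam) * (lam ^+ k / k`!%:R)).
Proof.
exists (@poisson_rank R); split.
- by [].
- exists 40, 1; split=> // eps e0 e2.
  (* The successor in [poisson_rank] adds 1, which is now at most 2 ln (1 / eps): hence 40 = 38 +
     2. *)
  have L2 : 2^-1 <= ln (1 / eps).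
    rewrite -ler_expR lnK ?posrE ?divr_gt0//.
    by apply: le_trans (expR_half_le2 R) _; rewrite ler_pdivlMr//; lra.
  rewrite powRr1; last by lra.
  have := truncn_itv (_ : 0 <= 38 * ln (1 / eps)) => /(_ ltac:(lra)) /andP[h _].
  rewrite /poisson_rank -natr1; lra.
- exists 2 => // eps e0 l j.
  have [c c0 cP] := block_corner R l j.
  have [alpha [beta ab]] := poisson_low_rank_corner e0 c0.
  exists alpha, beta => k lam lam0 /cP[kc klam]; exact: ab.
Qed.
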